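(* Assume $q\in\mathbb F$. Let $\Phi=(A;\{E_i\}_{i=0}^d;A^*;\{E^*_i\}_{i=0}^d)$ be a tridiagonal system on $V$ with $d\geq1$ such that each $E_iV$ and each $E^*_iV$ has dimension one, with eigenvalues $\theta_i=q^{2i-d}$ and dual eigenvalues $\theta^*_i=q^{d-2i}$ ($0\le i\le d$). Regard $V$ as a $U^+_q$-module with $W_0$ acting as $A$ and $W_1$ as $A^*$. Let $\xi$ and $x_{12},x_{23}$ be as in the context, and let $\{r_n\}_{n\in\mathbb N}$ be the unique sequence in $\mathbb F$ with $r_0=1$ such that $W_{-n}=r_nx_{12}-q\xi r_{n-1}I$ on $V$ for all $n\in\mathbb N$ (with $r_{-1}=0$). Let $R(t)=\sum_{n\in\mathbb N}r_nt^n$. Then, as formal power series, $$R(qt)R(q^{-1}t)=\frac{1}{(1-qt)(1-q^{d+2}\xi t)(1-q^{-d}\xi t)}.$$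
   Context: $\mathbb F$ is a field; $q$ is a nonzero element of $\mathbb F$ that is not a root of unity; $b=q^2$. A TD pair on a nonzero finite-dimensional $\mathbb F$-space $V$ is an ordered pair $A,A^*\in\mathrm{End}(V)$, each diagonalizable, such that for some ordering $\{V_i\}_{i=0}^d$ of the eigenspaces of $A$, $A^*V_i\subseteq V_{i-1}+V_i+V_{i+1}$ ($V_{-1}=V_{d+1}=0$), for some ordering $\{V^*_i\}$ of the eigenspaces of $A^*$, $AV^*_i\subseteq V^*_{i-1}+V^*_i+V^*_{i+1}$, and no subspace other than $0,V$ is invariant under both; such orderings are standard. A TD system is $(A;\{E_i\};A^*;\{E^*_i\})$ with $A,A^*$ a TD pair and $\{E_i\}$, $\{E^*_i\}$ the primitive idempotents of $A$, $A^*$ in standard orderings (both index sets run over $0,\dots,d$). $U^+_q$ is the algebra generated by $W_0,W_1$ with relations $[W_0,[W_0,[W_0,W_1]_b]_{b^{-1}}]=0$, $[W_1,[W_1,[W_1,W_0]_b]_{b^{-1}}]=0$ ($[X,Y]=XY-YX$, $[X,Y]_b=bXY-YX$); under the stated hypotheses $A,A^*$ satisfy these relations. Alternating elements, defined recursively with $G_0=\tilde G_0=1$: for $n\geq1$, $G_n=\frac{\sum_{k=0}^{n-1}W_{-k}W_{n-k}b^{-k}-\sum_{k=1}^{n-1}G_k\tilde G_{n-k}b^{-k}}{1+b^{-n}}+\frac{[W_n,W_0]}{(1+b^{-n})(1-b^{-1})}$, $\tilde G_n=G_n+\frac{[W_0,W_n]}{1-b^{-1}}$, $W_{-n}=\frac{[W_0,G_n]_b}{b-1}$,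 $W_{n+1}=\frac{[G_n,W_1]_b}{b-1}$ (computed in the order $W_0,W_1,G_1,\tilde G_1,W_{-1},W_2,G_2,\dots$). Define $x_{12}=A$, $x_{30}=A^*$; $x_{01}\in\mathrm{End}(V)$ acts as $q^{d-2i}$ on $(E^*_{d-i}V+\cdots+E^*_dV)\cap(E_iV+\cdots+E_dV)$ and $x_{23}\in\mathrm{End}(V)$ acts as $q^{2i-d}$ on $(E^*_0V+\cdots+E^*_iV)\cap(E_0V+\cdots+E_{d-i}V)$, for $0\leq i\leq d$ (these subspaces form direct sum decompositions of $V$). It is known that there is a unique nonzero $\xi\in\mathbb F$ with $\xi(x_{01}-x_{23})=[x_{30},x_{12}]/(q-q^{-1})$ and $\xi^{-1}(x_{12}-x_{30})=[x_{01},x_{23}]/(q-q^{-1})$. It is also known (Lemma 10.5 of the paper) that the sequence $\{r_n\}$ exists; it is unique since $A$ is not a scalar. *)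

(* Defs.v *)
From HB Require Import structures.
From mathcomp Require Import all_boot all_order all_algebra.
From mathcomp Require Import boolp.

Set Implicit Arguments.
Unset Strict Implicit.
Unset Printing Implicit Defensive.

Import GRing.Theory.
Local Open Scope ring_scope.
Local Open Scope quotient_scope.

Record fps (F : fieldType) := Fps { fps_coef :> nat -> F }.

Section FpsRing.
Variable F : fieldType.
Implicit Types f g h : fps F.

HB.instance Definition _ := gen_eqMixin (fps F).
HB.instance Definition _ := gen_choiceMixin (fps F).

Lemma fpsP f g : (forall n, f n = g n) -> f = g.
Proof. by case: f g => [f] [g] /= fg; congr Fps; apply/funext. Qed.

Definition fps_of_poly (p : {poly F}) : fps F := Fps (fun n => p`_n).

Definition fps_add f g := Fps (fun n => f n + g n).
Definition fps_opp f := Fps (fun n => - f n).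
Definition fps_mul f g := Fps (fun n => \sum_(i < n.+1) f i * g (n - i)%N).

Fact fps_addA : associative fps_add.
Proof. by move=> f g h; apply: fpsP => n /=; rewrite addrA. Qed.
Fact fps_addC : commutative fps_add.
Proof. by move=> f g; apply: fpsP => n /=; rewrite addrC. Qed.
Fact fps_add0 : left_id (fps_of_poly 0) fps_add.
Proof. by move=> f; apply: fpsP => n /=; rewrite coef0 add0r. Qed.
Fact fps_addN : left_inverse (fps_of_poly 0) fps_opp fps_add.
Proof. by move=> f; apply: fpsP => n /=; rewrite coef0 addNr. Qed.

HB.instance Definition _ :=
  GRing.isZmodule.Build (fps F) fps_addA fps_addC fps_add0 fps_addN.

Let trunc m f : {poly F} := \poly_(i < m) f i.

Let mul_trunc m f g n : (n < m)%N -> fps_mul f g n = (trunc m f * trunc m g)`_n.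
Proof.
move=> lt_nm; rewrite coefM /=; apply: eq_bigr => i _; rewrite !coef_poly.
by rewrite (leq_ltn_trans _ lt_nm) ?(leq_ltn_trans (leq_subr _ _) lt_nm) // -ltnS.
Qed.

Fact fps_mulC : commutative fps_mul.
Proof.
by move=> f g; apply: fpsP => n; rewrite !(@mul_trunc n.+1) // mulrC.
Qed.

Let coef_trunc m f n : (n < m)%N -> (trunc m f)`_n = f n.
Proof. by move=> lt_nm; rewrite coef_poly lt_nm. Qed.

Fact fps_mulA : associative fps_mul.
Proof.
move=> f g h; apply: fpsP => n.
transitivity ((trunc n.+1 f * (trunc n.+1 g * trunc n.+1 h))`_n).
  rewrite coefM; apply: eq_bigr => i _; have le_in : (i < n.+1)%N by [].
  by rewrite coef_trunc // -mul_trunc // ltnS leq_subr.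
rewrite mulrA coefM; apply: eq_bigr => i _.
by rewrite -mul_trunc // coef_trunc // ltnS leq_subr.
Qed.

Fact fps_mul1 : left_id (fps_of_poly 1) fps_mul.
Proof.
move=> f; apply: fpsP => n /=; rewrite big_ord_recl /= subn0 coef1 mul1r.
by rewrite big1 ?addr0 // => i _; rewrite coef1 mul0r.
Qed.

Fact fps_mulDl : left_distributive fps_mul +%R.
Proof.
move=> f g h; apply: fpsP => n /=.
by rewrite -big_split; apply: eq_bigr => i _; rewrite mulrDl.
Qed.

Fact fps_1neq0 : fps_of_poly 1 != 0.
Proof.
apply/eqP => /(congr1 (fun f : fps F => f 0%N)) /eqP.
by rewrite /= coef1 coef0 oner_eq0.
Qed.

HB.instance Definition _ := GRing.Zmodule_isComNzRing.Build (fps F)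
  fps_mulA fps_mulC fps_mul1 fps_mulDl fps_1neq0.

(* The inverse of an invertible series; as usual in MathComp, [f^-1 = f] when
   [f] is not invertible. *)
Definition fps_unit : {pred fps F} := fun f => `[< exists g, g * f = 1 >].
Definition fps_inv f : fps F :=
  if pselect (exists g, g * f = 1) is left ex then projT1 (cid ex) else f.

Fact fps_mulVx : {in fps_unit, left_inverse 1 fps_inv *%R}.
Proof.
move=> f /asboolP uf; rewrite /fps_inv.
by case: pselect => // ex; case: (cid ex).
Qed.
Fact fps_unitPl f g : g * f = 1 -> fps_unit f.
Proof. by move=> gf; apply/asboolP; exists g. Qed.
Fact fps_inv_out : {in [predC fps_unit], fps_inv =1 id}.
Proof.
move=> f /negP nuf; rewrite /fps_inv; case: pselect => // ex.
by case: nuf; apply/asboolP.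
Qed.

HB.instance Definition _ := GRing.ComNzRing_hasMulInverse.Build (fps F)
  fps_mulVx fps_unitPl fps_inv_out.

(* [fps_subst f c] is the series f(ct). *)
Definition fps_subst f (c : F) : fps F := Fps (fun n => c ^+ n * f n).

End FpsRing.

Section Alternating.
Variables (F : fieldType) (U : algType F).

Definition comm (x y : U) : U := x * y - y * x.
Definition qcomm (c : F) (x y : U) : U := c *: (x * y) - y * x.

Definition qSerre (b : F) (x y : U) : Prop :=
  comm x (qcomm b^-1 x (qcomm b x y)) = 0.

Variables (b : F) (W0 W1 : U).

(* The four families after n rounds of the recursion:
     alt_neg k = W_{-k}, alt_pos k = W_{k+1}, alt_G k = G_k, alt_Gt k = G~_k;
   only the values at k <= n are meaningful. *)
Record alt_state := AltState {
  alt_neg : nat -> U; alt_pos : nat -> U; alt_G : nat -> U; alt_Gt : nat -> U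
}.

Definition alt_update (f : nat -> U) (n : nat) (x : U) : nat -> U :=
  fun k => if (k < n)%N then f k else x.

(* Round n >= 1, given the values computed in the previous rounds.  For
   0 <= k < n the element W_{n-k} is [alt_pos s (n - k).-1]. *)
Definition alt_step (s : alt_state) (n : nat) : alt_state :=
  let Wn := alt_pos s n.-1 in
  let Gn :=
    (1 + b ^- n)^-1 *:
      (\sum_(0 <= k < n) b ^- k *: (alt_neg s k * alt_pos s (n - k).-1)
       - \sum_(1 <= k < n) b ^- k *: (alt_G s k * alt_Gt s (n - k)%N))
    + ((1 + b ^- n) * (1 - b^-1))^-1 *: comm Wn W0 in
  let Gtn := Gn + (1 - b^-1)^-1 *: comm W0 Wn in
  AltState
    (alt_update (alt_neg s) n ((b - 1)^-1 *: qcomm b W0 Gn))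
    (alt_update (alt_pos s) n ((b - 1)^-1 *: qcomm b Gn W1))
    (alt_update (alt_G s) n Gn)
    (alt_update (alt_Gt s) n Gtn).

Fixpoint alt_upto (n : nat) : alt_state :=
  if n is m.+1 then alt_step (alt_upto m) n
  else AltState (fun=> W0) (fun=> W1) (fun=> 1) (fun=> 1).

(* W_{-n}, W_{n+1}, G_n, G~_n *)
Definition Wneg (n : nat) : U := alt_neg (alt_upto n) n.
Definition Wpos (n : nat) : U := alt_pos (alt_upto n) n.
Definition Gelt (n : nat) : U := alt_G (alt_upto n) n.
Definition Gtelt (n : nat) : U := alt_Gt (alt_upto n) n.

Lemma alt_uptoE n k : (k <= n)%N ->
  [/\ alt_neg (alt_upto n) k = Wneg k, alt_pos (alt_upto n) k = Wpos k,
      alt_G (alt_upto n) k = Gelt k & alt_Gt (alt_upto n) k = Gtelt k].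
Proof.
elim: n => [|n IHn]; first by rewrite leqn0 => /eqP->.
rewrite leq_eqVlt => /orP[/eqP-> //|lt_kn].
by have [<- <- <- <-] := IHn lt_kn; rewrite /= /alt_update lt_kn.
Qed.

Lemma alt0 : [/\ Wneg 0 = W0, Wpos 0 = W1, Gelt 0 = 1 & Gtelt 0 = 1].
Proof. by []. Qed.

Lemma GeltS m (n := m.+1) : Gelt n =
  (1 + b ^- n)^-1 *:
    (\sum_(0 <= k < n) b ^- k *: (Wneg k * Wpos (n - k).-1)
     - \sum_(1 <= k < n) b ^- k *: (Gelt k * Gtelt (n - k)))
  + ((1 + b ^- n) * (1 - b^-1))^-1 *: comm (Wpos m) W0.
Proof.
rewrite /Gelt /= /alt_update ltnn; congr (_ *: (_ - _) + _).
  apply: eq_big_nat => k; rewrite ltnS => /= le_km.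
  have [-> _ _ _] := alt_uptoE le_km.
  by have [|_ -> _ _] // := @alt_uptoE m (n - k).-1; rewrite subSKn leq_subr.
apply: eq_big_nat => k /andP[k_gt0]; rewrite ltnS => le_km.
have [_ _ -> _] := alt_uptoE le_km.
have [|_ _ _ ->] // := @alt_uptoE m (n - k)%N.
by rewrite /n leq_subLR -add1n leq_add2r.
Qed.

Lemma GteltS m (n := m.+1) :
  Gtelt n = Gelt n + (1 - b^-1)^-1 *: comm W0 (Wpos m).
Proof. by rewrite /Gtelt /Gelt /= /alt_update ltnn. Qed.

Lemma WnegS m (n := m.+1) : Wneg n = (b - 1)^-1 *: qcomm b W0 (Gelt n).
Proof. by rewrite /Wneg /Gelt /= /alt_update ltnn. Qed.

Lemma WposS m (n := m.+1) : Wpos n = (b - 1)^-1 *: qcomm b (Gelt n) W1.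
Proof. by rewrite /Wpos /Gelt /= /alt_update ltnn. Qed.

End Alternating.

(* U_q^+ is the F-algebra presented by the generators W_0, W_1 and the two
   q-Serre relations; it is built as a quotient of formal expressions.  It
   depends on q only through b = q^2. *)
Inductive uq_term (F : fieldType) : Type :=
  | UqW0
  | UqW1
  | UqScalar of F
  | UqAdd of uq_term F & uq_term F
  | UqMul of uq_term F & uq_term F.

Arguments UqW0 {F}.
Arguments UqW1 {F}.

Section UqTerm.
Variables (F : fieldType) (b : F).
Local Notation T := (uq_term F).
Implicit Types x y z : T.

HB.instance Definition _ := gen_eqMixin T.
HB.instance Definition _ := gen_choiceMixin T.

Definition uq_tcomm (c : F) x y : T :=
  UqAdd (UqMul (UqScalar c) (UqMul x y)) (UqMul (UqScalar (- 1)) (UqMul y x)).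

Definition uq_tserre x y : T :=
  uq_tcomm 1 x (uq_tcomm b^-1 x (uq_tcomm b x y)).

(* The least congruence making the quotient an associative unital F-algebra in
   which the q-Serre relations hold. *)
Inductive uq_rel : T -> T -> Prop :=
  | uq_refl x : uq_rel x x
  | uq_sym x y : uq_rel x y -> uq_rel y x
  | uq_trans x y z : uq_rel x y -> uq_rel y z -> uq_rel x z
  | uq_congD x x' y y' :
      uq_rel x x' -> uq_rel y y' -> uq_rel (UqAdd x y) (UqAdd x' y')
  | uq_congM x x' y y' :
      uq_rel x x' -> uq_rel y y' -> uq_rel (UqMul x y) (UqMul x' y')
  | uq_addA x y z : uq_rel (UqAdd x (UqAdd y z)) (UqAdd (UqAdd x y) z)
  | uq_addC x y : uq_rel (UqAdd x y) (UqAdd y x)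
  | uq_add0 x : uq_rel (UqAdd (UqScalar 0) x) x
  | uq_mul0 x : uq_rel (UqMul (UqScalar 0) x) (UqScalar 0)
  | uq_mulA x y z : uq_rel (UqMul x (UqMul y z)) (UqMul (UqMul x y) z)
  | uq_mul1 x : uq_rel (UqMul (UqScalar 1) x) x
  | uq_mulDl x y z :
      uq_rel (UqMul (UqAdd x y) z) (UqAdd (UqMul x z) (UqMul y z))
  | uq_mulDr x y z :
      uq_rel (UqMul x (UqAdd y z)) (UqAdd (UqMul x y) (UqMul x z))
  | uq_scalarD c e :
      uq_rel (UqScalar (c + e)) (UqAdd (UqScalar c) (UqScalar e))
  | uq_scalarM c e :
      uq_rel (UqScalar (c * e)) (UqMul (UqScalar c) (UqScalar e))
  | uq_scalarC c x : uq_rel (UqMul (UqScalar c) x) (UqMul x (UqScalar c))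
  | uq_serre01 : uq_rel (uq_tserre UqW0 UqW1) (UqScalar 0)
  | uq_serre10 : uq_rel (uq_tserre UqW1 UqW0) (UqScalar 0).

Definition uq_relb : rel T := fun x y => `[< uq_rel x y >].

Fact uq_relb_refl : reflexive uq_relb.
Proof. by move=> x; apply/asboolP/uq_refl. Qed.
Fact uq_relb_sym : symmetric uq_relb.
Proof. by move=> x y; apply/asboolP/asboolP; apply: uq_sym. Qed.
Fact uq_relb_trans : transitive uq_relb.
Proof.
move=> y x z /asboolP xy /asboolP yz; apply/asboolP.
exact: uq_trans xy yz.
Qed.

Canonical uq_equiv := EquivRel uq_relb uq_relb_refl uq_relb_sym uq_relb_trans.

End UqTerm.

Definition Uqplus (F : fieldType) (b : F) := {eq_quot (uq_equiv b)}.

Section UqAlgebra.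
Variables (F : fieldType) (b : F).
Local Notation U := (Uqplus b).
Implicit Types x y z : U.

HB.instance Definition _ := Choice.on U.

Definition uq_pi (t : uq_term F) : U := \pi_({eq_quot (uq_equiv b)}) t.

Lemma uq_piP s t : uq_pi s = uq_pi t <-> uq_rel b s t.
Proof.
split=> [st|st]; last by apply/eqmodP/asboolP.
by move/eqmodP: st => /= /asboolP.
Qed.

Lemma uq_reprK x : uq_pi (repr x) = x. Proof. exact: reprK. Qed.
Lemma uq_piK t : uq_rel b (repr (uq_pi t)) t.
Proof. by apply/uq_piP; rewrite uq_reprK. Qed.

Definition uq_add x y := uq_pi (UqAdd (repr x) (repr y)).
Definition uq_mul x y := uq_pi (UqMul (repr x) (repr y)).
Definition uq_scale (c : F) x := uq_pi (UqMul (UqScalar c) (repr x)).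
Definition uq_zero := uq_pi (UqScalar 0).
Definition uq_one := uq_pi (UqScalar 1).
Definition uq_opp x := uq_scale (- 1) x.

Lemma uq_piD s t : uq_add (uq_pi s) (uq_pi t) = uq_pi (UqAdd s t).
Proof. by apply/uq_piP; apply: uq_congD; apply: uq_piK. Qed.
Lemma uq_piM s t : uq_mul (uq_pi s) (uq_pi t) = uq_pi (UqMul s t).
Proof. by apply/uq_piP; apply: uq_congM; apply: uq_piK. Qed.
Lemma uq_piZ c t : uq_scale c (uq_pi t) = uq_pi (UqMul (UqScalar c) t).
Proof. by apply/uq_piP/uq_congM; [apply: uq_refl|apply: uq_piK]. Qed.

Let uqE := (uq_piD, uq_piM, uq_piZ).

Lemma uq_ind (P : U -> Prop) : (forall t, P (uq_pi t)) -> forall x, P x.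
Proof. by move=> Pt x; rewrite -(uq_reprK x). Qed.

Fact uq_qaddA : associative uq_add.
Proof.
elim/uq_ind=> s; elim/uq_ind=> t; elim/uq_ind=> u; rewrite !uqE.
exact/uq_piP/uq_addA.
Qed.
Fact uq_qaddC : commutative uq_add.
Proof.
by elim/uq_ind=> s; elim/uq_ind=> t; rewrite !uqE; apply/uq_piP/uq_addC.
Qed.
Fact uq_qadd0 : left_id uq_zero uq_add.
Proof. by elim/uq_ind=> s; rewrite !uqE; apply/uq_piP/uq_add0. Qed.
Fact uq_qscaleDl x c e : uq_scale (c + e) x = uq_add (uq_scale c x) (uq_scale e x).
Proof.
elim/uq_ind: x => s; rewrite !uqE; apply/uq_piP.
apply: uq_trans (uq_mulDl _ _ _ _).
exact: uq_congM (uq_scalarD _ _ _) (uq_refl _ _).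
Qed.
Fact uq_qscale1 : left_id 1 uq_scale.
Proof. by elim/uq_ind=> s; rewrite !uqE; apply/uq_piP/uq_mul1. Qed.
Fact uq_qscaleA c e x : uq_scale c (uq_scale e x) = uq_scale (c * e) x.
Proof.
elim/uq_ind: x => s; rewrite !uqE; apply/uq_piP.
apply: uq_trans (uq_mulA _ _ _ _) _.
exact: uq_congM (uq_sym (uq_scalarM _ _ _)) (uq_refl _ _).
Qed.
Fact uq_qscaleDr : right_distributive uq_scale uq_add.
Proof.
by move=> c; elim/uq_ind=> s; elim/uq_ind=> t; rewrite !uqE; apply/uq_piP/uq_mulDr.
Qed.
Fact uq_qscale0 x : uq_scale 0 x = uq_zero.
Proof. by elim/uq_ind: x => s; rewrite !uqE; apply/uq_piP/uq_mul0. Qed.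
Fact uq_qaddN : left_inverse uq_zero uq_opp uq_add.
Proof.
move=> x; rewrite -[in X in uq_add _ X](uq_qscale1 x) -uq_qscaleDl.
by rewrite addNr uq_qscale0.
Qed.

HB.instance Definition _ :=
  GRing.isZmodule.Build U uq_qaddA uq_qaddC uq_qadd0 uq_qaddN.

Fact uq_qmulA : associative uq_mul.
Proof.
elim/uq_ind=> s; elim/uq_ind=> t; elim/uq_ind=> u; rewrite !uqE.
exact/uq_piP/uq_mulA.
Qed.
Fact uq_qmul1 : left_id uq_one uq_mul.
Proof. by elim/uq_ind=> s; rewrite !uqE; apply/uq_piP/uq_mul1. Qed.
Fact uq_qmulr1 : right_id uq_one uq_mul.
Proof.
elim/uq_ind=> s; rewrite !uqE; apply/uq_piP.
exact: uq_trans (uq_sym (uq_scalarC _ _ _)) (uq_mul1 _ _).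
Qed.
Fact uq_qmulDl : left_distributive uq_mul +%R.
Proof.
elim/uq_ind=> s; elim/uq_ind=> t; elim/uq_ind=> u.
by rewrite /GRing.add /= !uqE; apply/uq_piP/uq_mulDl.
Qed.
Fact uq_qmulDr : right_distributive uq_mul +%R.
Proof.
elim/uq_ind=> s; elim/uq_ind=> t; elim/uq_ind=> u.
by rewrite /GRing.add /= !uqE; apply/uq_piP/uq_mulDr.
Qed.

End UqAlgebra.

Section UqEval.
Variables (F : fieldType) (b : F) (B : algType F) (x0 x1 : B).
Local Notation U := (Uqplus b).

Fixpoint uq_teval (t : uq_term F) : B :=
  match t with
  | UqW0 => x0
  | UqW1 => x1
  | UqScalar c => c%:A
  | UqAdd s t => uq_teval s + uq_teval t
  | UqMul s t => uq_teval s * uq_teval t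
  end.

Hypotheses (x01 : qSerre b x0 x1) (x10 : qSerre b x1 x0).

Lemma uq_teval_comm c s t :
  uq_teval (uq_tcomm c s t) = qcomm c (uq_teval s) (uq_teval t).
Proof. by rewrite /= -!scalerAl !mul1r scaleN1r. Qed.

Lemma uq_teval_serre s t :
  uq_teval (uq_tserre b s t) =
  comm (uq_teval s) (qcomm b^-1 (uq_teval s) (qcomm b (uq_teval s) (uq_teval t))).
Proof. by rewrite !uq_teval_comm /qcomm /comm scale1r. Qed.

Lemma uq_teval_rel s t : uq_rel b s t -> uq_teval s = uq_teval t.
Proof.
elim=> {s t}.
- by [].
- by move=> s t _ ->.
- by move=> s t u _ -> _ ->.
- by move=> s s' t t' _ IHs _ IHt /=; rewrite IHs IHt.
- by move=> s s' t t' _ IHs _ IHt /=; rewrite IHs IHt.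
- by move=> s t u /=; rewrite addrA.
- by move=> s t /=; rewrite addrC.
- by move=> s /=; rewrite scale0r add0r.
- by move=> s /=; rewrite scale0r mul0r.
- by move=> s t u /=; rewrite mulrA.
- by move=> s /=; rewrite scale1r mul1r.
- by move=> s t u /=; rewrite mulrDl.
- by move=> s t u /=; rewrite mulrDr.
- by move=> c e /=; rewrite scalerDl.
- by move=> c e /=; rewrite -scalerAl mul1r scalerA.
- by move=> c s /=; rewrite -scalerAl mul1r -scalerAr mulr1.
- by rewrite uq_teval_serre /= scale0r.
- by rewrite uq_teval_serre /= scale0r.
Qed.

Definition uq_eval (x : U) : B := uq_teval (repr x).

Lemma uq_eval_pi t : uq_eval (uq_pi b t) = uq_teval t.
Proof. exact/uq_teval_rel/uq_piK. Qed.

End UqEval.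

Section UqRing.
Variables (F : fieldType) (b : F).
Local Notation U := (Uqplus b).

Fact uq_1neq0 : uq_one b != 0 :> U.
Proof.
apply/eqP => /uq_piP E.
have S0 : qSerre b (0 : F^o) 0 by rewrite /qSerre /comm mulr0 mul0r subrr.
by have /eqP := uq_teval_rel S0 S0 E; rewrite /= scale1r scale0r oner_eq0.
Qed.

HB.instance Definition _ := GRing.Zmodule_isNzRing.Build U
  (@uq_qmulA F b) (@uq_qmul1 F b) (@uq_qmulr1 F b)
  (@uq_qmulDl F b) (@uq_qmulDr F b) uq_1neq0.

HB.instance Definition _ := GRing.Zmodule_isLmodule.Build F U
  (fun c e x => @uq_qscaleA F b c e x) (@uq_qscale1 F b)
  (@uq_qscaleDr F b) (fun x c e => @uq_qscaleDl F b x c e).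

Fact uq_qscaleAl (c : F) (x y : U) : c *: (x * y) = (c *: x) * y.
Proof.
elim/uq_ind: x => s; elim/uq_ind: y => t.
by rewrite /GRing.mul /GRing.scale /= !(uq_piM, uq_piZ); apply/uq_piP/uq_mulA.
Qed.
HB.instance Definition _ := GRing.Lmodule_isLalgebra.Build F U uq_qscaleAl.

Fact uq_qscaleAr (c : F) (x y : U) : c *: (x * y) = x * (c *: y).
Proof.
elim/uq_ind: x => s; elim/uq_ind: y => t.
rewrite /GRing.mul /GRing.scale /= !(uq_piM, uq_piZ); apply/uq_piP.
apply: uq_trans (uq_mulA _ _ _ _) _; apply: uq_trans (uq_sym (uq_mulA _ _ _ _)).
exact: uq_congM (uq_scalarC _ _ _) (uq_refl _ _).
Qed.
HB.instance Definition _ := GRing.Lalgebra_isAlgebra.Build F U uq_qscaleAr.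

Definition uqW0 : U := uq_pi b UqW0.
Definition uqW1 : U := uq_pi b UqW1.

Lemma uq_piDE s t : uq_pi b (UqAdd s t) = uq_pi b s + uq_pi b t.
Proof. by rewrite -uq_piD. Qed.
Lemma uq_piME s t : uq_pi b (UqMul s t) = uq_pi b s * uq_pi b t.
Proof. by rewrite -uq_piM. Qed.
Lemma uq_pi_scalar c : uq_pi b (UqScalar c) = c%:A.
Proof.
rewrite [RHS]uq_piZ; apply/uq_piP; rewrite -{1}[c]mulr1; exact: uq_scalarM.
Qed.

Lemma uq_pi_comm c s t : uq_pi b (uq_tcomm c s t) = qcomm c (uq_pi b s) (uq_pi b t).
Proof.
by rewrite !(uq_piDE, uq_piME, uq_pi_scalar) -!scalerAl !mul1r scaleN1r.
Qed.

Lemma uq_Serre01 : qSerre b uqW0 uqW1.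
Proof.
have /(uq_piP b) := uq_serre01 b.
by rewrite !uq_pi_comm uq_pi_scalar scale0r {1}/qcomm scale1r.
Qed.
Lemma uq_Serre10 : qSerre b uqW1 uqW0.
Proof.
have /(uq_piP b) := uq_serre10 b.
by rewrite !uq_pi_comm uq_pi_scalar scale0r {1}/qcomm scale1r.
Qed.

Lemma uq_universal (B : algType F) (x0 x1 : B) :
    qSerre b x0 x1 -> qSerre b x1 x0 ->
  exists f : {lrmorphism U -> B},
    (f uqW0 = x0 /\ f uqW1 = x1) /\
    (forall g : {lrmorphism U -> B}, g uqW0 = x0 -> g uqW1 = x1 -> g =1 f).
Proof.
move=> S01 S10; pose f : U -> B := uq_eval x0 x1.
have fpi t : f (uq_pi b t) = uq_teval x0 x1 t by exact: uq_eval_pi.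
have f_lin : linear f.
  move=> c; elim/uq_ind=> s; elim/uq_ind=> t.
  by rewrite [c *: _]uq_piZ -uq_piDE !fpi /= -scalerAl mul1r.
have f_mon : monoid_morphism f.
  split; first by rewrite [1]/(uq_pi b (UqScalar 1)) fpi /= scale1r.
  by elim/uq_ind=> s; elim/uq_ind=> t; rewrite -uq_piME !fpi.
pose fL := GRing.isLinear.Build _ _ _ _ f f_lin.
pose fM := GRing.isMonoidMorphism.Build _ _ f f_mon.
pose fLR : {lrmorphism U -> B} := HB.pack f fL fM.
exists fLR; split; first by split; exact: fpi.
move=> g g0 g1; elim/uq_ind=> t; rewrite [RHS]fpi.
elim: t => [||c|s IHs t IHt|s IHs t IHt] //=.
- by rewrite uq_pi_scalar linearZ /= rmorph1.
- by rewrite uq_piDE rmorphD -IHs -IHt.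
- by rewrite uq_piME rmorphM -IHs -IHt.
Qed.

End UqRing.

(* V is a left U-module through rho.  Multiplication in U is sent to
   composition \o; the (non canonical) ring structure that MathComp puts on
   'End(V) has the opposite product, whence the explicit formulation. *)
Record module_structure (F : fieldType) (U : algType F) (V : vectType F)
    (rho : U -> 'End(V)) : Prop := ModuleStructure {
  module_linear : linear rho;
  module_one : rho 1 = \1%VF;
  module_mul : forall x y, rho (x * y) = (rho x \o rho y)%VF
}.

Section Tridiagonal.
Variables (F : fieldType) (V : vectType F).
Implicit Types A B As : 'End(V).

Definition lfun_comm A B : 'End(V) := (A \o B)%VF - (B \o A)%VF.

Definition lfun_diagonalizable A : Prop :=
  exists s : seq F, (\sum_(a <- s) passmx.leigenspace A a)%VS = fullv.

Definition eigenspace_ordering A (d : nat) (W : 'I_d.+1 -> {vspace V}) : Prop :=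
  injective W /\
  (forall U, (exists i, W i = U) <->
             (exists2 a, passmx.leigenvalue A a & passmx.leigenspace A a = U)).

Definition tridiagonal_on B (d : nat) (W : 'I_d.+1 -> {vspace V}) : Prop :=
  forall i, (B @: W i <= \sum_(j : 'I_d.+1 | (j <= i.+1)%N && (i <= j.+1)%N) W j)%VS.

Definition standard_ordering A B (d : nat) (W : 'I_d.+1 -> {vspace V}) : Prop :=
  eigenspace_ordering A W /\ tridiagonal_on B W.

Record TD_pair A As : Prop := TDPair {
  TD_nonzero : fullv != 0%VS :> {vspace V};
  TD_diag : lfun_diagonalizable A;
  TD_diag_dual : lfun_diagonalizable As;
  TD_standard : exists d (W : 'I_d.+1 -> {vspace V}), standard_ordering A As W;
  TD_standard_dual :
    exists d (W : 'I_d.+1 -> {vspace V}), standard_ordering As A W;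
  TD_irreducible : forall W : {vspace V},
    (A @: W <= W)%VS -> (As @: W <= W)%VS -> W = 0%VS \/ W = fullv
}.

(* E_i is the projection onto W_i along the sum of the other W_j. *)
Definition primitive_idempotents (d : nat) (W : 'I_d.+1 -> {vspace V})
    (E : 'I_d.+1 -> 'End(V)) : Prop :=
  forall i j v, v \in W j -> E i v = if i == j then v else 0.

Definition standard_idempotents A B (d : nat) (E : 'I_d.+1 -> 'End(V)) : Prop :=
  exists2 W, standard_ordering A B W & primitive_idempotents W E.

Record TD_system (d : nat) A (E : 'I_d.+1 -> 'End(V))
    As (Es : 'I_d.+1 -> 'End(V)) : Prop := TDSystem {
  TDS_pair : TD_pair A As;
  TDS_idem : standard_idempotents A As E;
  TDS_idem_dual : standard_idempotents As A Es
}.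

Definition eigenvalue_sequence A (d : nat) (E : 'I_d.+1 -> 'End(V))
    (theta : 'I_d.+1 -> F) : Prop :=
  forall i, passmx.leigenvalue A (theta i) /\ limg (E i) = passmx.leigenspace A (theta i).

Definition acts_as_on (X : 'End(V)) (c : F) (W : {vspace V}) : Prop :=
  forall v, v \in W -> X v = c *: v.

End Tridiagonal.

(* r_{n-1}, with the convention r_{-1} = 0. *)
Definition pred_term (F : fieldType) (r : nat -> F) (n : nat) : F :=
  if n is m.+1 then r m else 0.

(* Main.v *)
Require Import Defs.
From HB Require Import structures.
From mathcomp Require Import all_boot all_order all_algebra.
From mathcomp Require Import ring zify.

(* With b = q^2, the alternating elements act on V by
     W_{-n} = r_n x12 - q xi r_{n-1},    W_{n+1} = r_n x30 - q xi r_{n-1},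
     G_n = r_n - q xi r_{n-1} x23,       G~_n = r_n - q xi r_{n-1} x01,
   so the recursion for G_n, which reads G(t/b) G~(t) = 1 + t W^-(t/b) W^+(t) in
   terms of generating functions, becomes
     R(t/b) R(t) ((1 - xi t x23 / q) (1 - q xi t x01)
                  - t (x12 - xi t / q) (x30 - q xi t)) = 1.
   The bracket is a scalar cubic, because x12 x30 + q xi x01 + xi x23 / q and
   x23 x01 + q x12 / xi + x30 / (q xi) commute with A and A^*.  Their eigenvalues
   c and c' follow from the fact that, along the vectors
   u_n = (A - th_{n-1}) ... (A - th_0) u with u in E^*_d V, A^* acts by
   A^* u_n = th_n u_n + phi_n u_{n-1}, where phi_n is an explicit Laurent
   polynomial in th_n with phi_0 = phi_{d+1} = 0. *)

Set Implicit Arguments.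
Unset Strict Implicit.
Unset Printing Implicit Defensive.

Import GRing.Theory.
Local Open Scope ring_scope.

Lemma coord_inj (F : fieldType) (V : vectType F) (v w : V) :
  (forall i, coord (vbasis fullv) i v = coord (vbasis fullv) i w) -> v = w.
Proof.
move=> vw; rewrite (coord_vbasis (memvf v)) (coord_vbasis (memvf w)).
by apply: eq_bigr => i _; rewrite vw.
Qed.

(* Passing to coordinates makes [ring] and [field] available for vectors. *)
Ltac coords :=
  apply: coord_inj => ?; rewrite !(linearB, linearD, linearN, linearZ) /= /GRing.scale /=.

(** * Split decompositions and the q-Weyl relations *)

Section Split.
Variables (F : fieldType) (V : vectType F) (d : nat).
Implicit Types (W : 'I_d.+1 -> {vspace V}) (f : 'End(V)).

Lemma sumv_lfun W (P : pred 'I_d.+1) f (T : {vspace V}) v :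
  (forall i w, P i -> w \in W i -> f w \in T) ->
  v \in (\sum_(i | P i) W i)%VS -> f v \in T.
Proof.
move=> fT /memv_sumP[w Ww ->]; rewrite linear_sum; apply: rpred_sum => i Pi.
exact: fT (Ww i Pi).
Qed.

Lemma memv_sum_sup W (P : pred 'I_d.+1) i v :
  P i -> v \in W i -> v \in (\sum_(j | P j) W j)%VS.
Proof. by move=> Pi; apply/subvP; apply: (sumv_sup i). Qed.

(** [f - c] acts on each [W i] as the scalar [th i - c], so it erases the summands with eigenvalue
    [c], and [Q] has to account only for the others. *)
Lemma sumv_shift W (P Q : pred 'I_d.+1) (f : 'End(V)) (th : 'I_d.+1 -> F) c v :
    (forall i w, w \in W i -> f w = th i *: w) ->
    (forall i, P i -> th i = c \/ Q i) ->
    v \in (\sum_(i | P i) W i)%VS ->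
  f v - c *: v \in (\sum_(i | Q i) W i)%VS.
Proof.
move=> fW PQ; have -> : f v - c *: v = (f - c *: \1%VF) v.
  by rewrite !(add_lfunE, opp_lfunE, scale_lfunE, id_lfunE).
apply: sumv_lfun => i w Pi Ww.
rewrite !(add_lfunE, opp_lfunE, scale_lfunE, id_lfunE) (fW _ _ Ww) -scalerBl.
have [->|Qi] := PQ i Pi; first by rewrite subrr scale0r mem0v.
by rewrite rpredZ // (memv_sum_sup Qi).
Qed.

Lemma sumv_trid W (P Q : pred 'I_d.+1) (f : 'End(V)) c v :
    tridiagonal_on f W ->
    (forall i j : 'I_d.+1, P i -> (j <= i.+1)%N -> (i <= j.+1)%N -> Q j) ->
    v \in (\sum_(i | P i) W i)%VS ->
  f v - c *: v \in (\sum_(i | Q i) W i)%VS.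
Proof.
move=> fW PQ; have -> : f v - c *: v = (f - c *: \1%VF) v.
  by rewrite !(add_lfunE, opp_lfunE, scale_lfunE, id_lfunE).
apply: sumv_lfun => i w Pi Ww.
rewrite !(add_lfunE, opp_lfunE, scale_lfunE, id_lfunE); apply: rpredB.
  have /subvP/(_ _ (memv_img f Ww)) := fW i; apply/subvP/subv_sumP => j /andP[ji ij].
  by apply: (sumv_sup j) => //; apply: PQ ji ij.
by rewrite rpredZ // (memv_sum_sup _ Ww) // (PQ i i Pi).
Qed.

Variables (A B : 'End(V)) (W Ws : 'I_d.+1 -> {vspace V}) (th : nat -> F).
Hypothesis A_W : forall i v, v \in W i -> A v = th i *: v.
Hypothesis B_Ws : forall i v, v \in Ws i -> B v = th i *: v.
Hypothesis B_trid : tridiagonal_on B W.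
Hypothesis A_trid : tridiagonal_on A Ws.
Hypothesis W_full : (\sum_i W i = fullv)%VS.
Hypothesis Ws0_neq0 : Ws ord0 != 0%VS.
Hypothesis irr : forall U : {vspace V},
    (A @: U <= U)%VS -> (B @: U <= U)%VS -> U = 0%VS \/ U = fullv.

(** Indexed by all of [nat]: the space is zero beyond [d], so raising has no boundary case. The
    orderings are taken so that [A] and [B] share the eigenvalue sequence [th]. *)
Definition split_space (i : nat) : {vspace V} :=
  ((\sum_(j : 'I_d.+1 | (j <= i)%N) Ws j) :&:
   (\sum_(j : 'I_d.+1 | (i <= j)%N) W j))%VS.

(** Subtracting [th i] removes [W i] from the second sum, while tridiagonality of [A] lengthens the
    first by one index. *)
Lemma split_raise i v :
  v \in split_space i -> A v - th i *: v \in split_space i.+1.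
Proof.
case/memv_capP=> vs v1; apply/memv_capP; split.
  by apply: sumv_trid A_trid _ vs => j k ji kj _; exact: leq_trans kj _.
apply: sumv_shift A_W _ v1 => j.
by rewrite leq_eqVlt => /orP[/eqP->|]; [left|right].
Qed.

Lemma split_lower i v :
  v \in split_space i.+1 -> B v - th i.+1 *: v \in split_space i.
Proof.
case/memv_capP=> vs v1; apply/memv_capP; split.
  apply: sumv_shift B_Ws _ vs => j.
  by rewrite leq_eqVlt => /orP[/eqP->|]; [left|right].
by apply: sumv_trid B_trid _ v1 => j k ij _ jk; exact: leq_trans ij jk.
Qed.

Lemma split_space0 v : v \in split_space 0 -> B v = th 0 *: v.
Proof.
case/memv_capP=> vs _; apply/eqP; rewrite -subr_eq0 -memv0.
have := @sumv_shift Ws _ pred0 B th (th 0) v B_Ws _ vs.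
rewrite big_pred0_eq; apply=> j.
by rewrite leqn0 => /eqP->; left.
Qed.

Lemma split_space_last i : (d < i)%N -> split_space i = 0%VS.
Proof.
move=> di; rewrite /split_space [X in (_ :&: X)%VS]big_pred0 ?capv0 // => j.
by apply/negbTE; rewrite -ltnNge (leq_trans (ltn_ord j)).
Qed.

(** The sum is stable under both maps by raising and lowering, and it contains the nonzero space
    [Ws ord0], so irreducibility makes it the whole space. *)
Lemma split_space_full : (\sum_(i < d.+1) split_space i = fullv)%VS.
Proof.
set S := (\sum_(i < _) _)%VS.
have sub_S i : (split_space i <= S)%VS.
  have [id|di] := ltnP i d.+1; last by rewrite split_space_last ?sub0v.
  exact: (sumv_sup (Ordinal id)).
have inv f (g : nat -> nat) :
    (forall i v, v \in split_space i -> f v - th i *: v \in split_space (g i)) ->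
  (f @: S <= S)%VS.
  move=> fS; rewrite limg_sum; apply/subv_sumP => i _; apply/subvP => _ /memv_imgP[v vi ->].
  rewrite -[f v](subrK (th i *: v)) rpredD ?rpredZ //.
    exact: subvP (sub_S _) _ (fS _ _ vi).
  exact: subvP (sub_S _) _ vi.
have SA : (A @: S <= S)%VS by apply: (inv A succn) => i v; apply: split_raise.
have SB : (B @: S <= S)%VS.
  (* [predn] fixes 0, which is harmless since [B - th 0] vanishes on [split_space 0]. *)
  apply: (inv B predn) => -[|i] v; last exact: split_lower.
  by move/split_space0->; rewrite subrr mem0v.
have [S0|//] := irr SA SB.
case/negP: Ws0_neq0; rewrite -subv0 -S0; apply: subv_trans (sub_S 0%N).
rewrite /split_space.
have -> : (\sum_(j : 'I_d.+1 | (0 <= j)%N) W j = fullv)%VS by [].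
by rewrite capvf (sumv_sup ord0).
Qed.

(* On the split decomposition A is x^-1 plus a raising map and B is x^-1 plus a
   lowering map. *)
Lemma split_weyl (p : F) (x : 'End(V)) v :
    (forall i, th i != 0) -> (forall i, th i.+1 = p * th i) -> p != 0 ->
    (forall i : 'I_d.+1, acts_as_on x (th i)^-1 (split_space i)) ->
  x (A v) = p^-1 *: A (x v) + (1 - p^-1) *: v /\
  B (x v) = p^-1 *: x (B v) + (1 - p^-1) *: v.
Proof.
move=> th0 thS p0 x_split.
have xU i w : w \in split_space i -> x w = (th i)^-1 *: w.
  have [id|di] := ltnP i d.+1; first exact: (x_split (Ordinal id)).
  by rewrite split_space_last // memv0 => /eqP->; rewrite linear0 scaler0.
have: v \in fullv by exact: memvf.
rewrite -split_space_full => /memv_sumP[w Uw ->]; rewrite !linear_sum -!big_split /=.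
split; apply: eq_bigr => i _; have {}Uw := Uw i isT; rewrite (xU _ _ Uw).
  rewrite linearZ /=.
  (* The raised vector [A (w i) - th i *: w i] lies in the next summand, where [x] is the scalar
     [(th i.+1)^-1]; this determines [x (A (w i))]. *)
  have := xU _ _ (split_raise Uw); rewrite linearB linearZ /= (xU _ _ Uw).
  move=> /(canRL (subrK _)) ->; rewrite thS; coords; field.
  by rewrite p0 th0.
rewrite linearZ /=; case: (i : nat) (th0 i) Uw => [|n] thi Uw.
  rewrite (split_space0 Uw) [x _]linearZ /= (xU _ _ Uw).
  by coords; field; rewrite thi p0.
have := xU _ _ (split_lower Uw); rewrite linearB linearZ /= (xU _ _ Uw).
move=> /(canRL (subrK _)) ->; move: thi; rewrite thS => thi.
by coords; field; rewrite p0 th0.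
Qed.

End Split.

(** The kernel of [Z - c] is stable under [A] and [B] and contains [u]. The known eigenvector stands
    in for algebraic closedness of the field. *)
Lemma schur (F : fieldType) (V : vectType F) (A B Z : 'End(V)) (u : V) (c : F) :
    (forall U : {vspace V},
       (A @: U <= U)%VS -> (B @: U <= U)%VS -> U = 0%VS \/ U = fullv) ->
    (forall v, Z (A v) = A (Z v)) -> (forall v, Z (B v) = B (Z v)) ->
    u != 0 -> Z u = c *: u ->
  forall v, Z v = c *: v.
Proof.
move=> irr ZA ZB u0 Zu.
have kerE v : (v \in lker (Z - c *: \1%VF)) = (Z v == c *: v).
  by rewrite memv_ker !(add_lfunE, opp_lfunE, scale_lfunE, id_lfunE) subr_eq0.
have inv (f : 'End(V)) : (forall v, Z (f v) = f (Z v)) ->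
    (f @: lker (Z - c *: \1%VF) <= lker (Z - c *: \1%VF))%VS.
  move=> Zf; apply/subvP => _ /memv_imgP[v + ->]; rewrite !kerE => /eqP Zv.
  by rewrite Zf Zv linearZ.
have [K0|Kf] := irr _ (inv A ZA) (inv B ZB).
  by have := kerE u; rewrite K0 memv0 Zu eqxx (negPf u0).
by move=> v; apply/eqP; rewrite -kerE Kf memvf.
Qed.

(** * Two operators commuting with the tridiagonal pair *)

Section WeylSquare.
Variables (F : fieldType) (V : vectType F) (q xi : F).
Variables (A As x01 x23 : 'End(V)).
Hypotheses (q0 : q != 0) (xi0 : xi != 0).
Hypothesis w01 : forall v, x01 (A v) = q ^- 2 *: A (x01 v) + (1 - q ^- 2) *: v.
Hypothesis w30 : forall v, As (x01 v) = q ^- 2 *: x01 (As v) + (1 - q ^- 2) *: v.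
Hypothesis w12 : forall v, A (x23 v) = q ^- 2 *: x23 (A v) + (1 - q ^- 2) *: v.
Hypothesis w23 : forall v, x23 (As v) = q ^- 2 *: As (x23 v) + (1 - q ^- 2) *: v.
Hypothesis comm_AsA :
  forall v, As (A v) = A (As v) + ((q - q^-1) * xi) *: (x01 v - x23 v).

Definition casimir : 'End(V) :=
  (A \o As)%VF + (q * xi) *: x01 + (q^-1 * xi) *: x23.
(** The image of [casimir] under the rotation [x12 -> x23 -> x30 -> x01 -> x12], where [x12 = A] and
    [x30 = As], with [xi] inverted. *)
Definition casimir' : 'End(V) :=
  (x23 \o x01)%VF + (q * xi^-1) *: A + (q^-1 * xi^-1) *: As.

Lemma casimirE v : casimir v = A (As v) + (q * xi) *: x01 v + (q^-1 * xi) *: x23 v.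
Proof. by rewrite !(add_lfunE, scale_lfunE, comp_lfunE). Qed.

Lemma casimir'E v :
  casimir' v = x23 (x01 v) + (q * xi^-1) *: A v + (q^-1 * xi^-1) *: As v.
Proof. by rewrite !(add_lfunE, scale_lfunE, comp_lfunE). Qed.

Let linE := (linearB, linearD, linearN, linearZ).

(** The weights [q] and [q^-1] are those for which the terms produced by [comm_AsA] cancel the
    failure of [x01] and [x23] to commute with [A]. *)
Lemma casimirA v : casimir (A v) = A (casimir v).
Proof.
rewrite !casimirE comm_AsA w01 !linE /= !w12.
by coords; field; rewrite ?q0.
Qed.

Lemma casimirAs v : casimir (As v) = As (casimir v).
Proof.
rewrite !casimirE !linE /= comm_AsA w30 !w23 !linE /=.
by coords; field; rewrite ?q0.
Qed.

Lemma casimir'A v : casimir' (A v) = A (casimir' v).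
Proof.
rewrite !casimir'E !linE /= w01 w12 !linE /= comm_AsA.
by coords; field; rewrite ?q0 ?xi0.
Qed.

Lemma casimir'As v : casimir' (As v) = As (casimir' v).
Proof.
have w23' u : As (x23 u) = q ^+ 2 *: x23 (As u) + (1 - q ^+ 2) *: u.
  by rewrite w23; coords; field.
rewrite !casimir'E !linE /= w23' w30 !linE /= comm_AsA.
by coords; field; rewrite ?q0 ?xi0.
Qed.

End WeylSquare.

(** * Cyclic chains of eigenvalue shifts *)

Section Chain.
Variables (F : fieldType) (V : vectType F) (A : 'End(V)) (th : nat -> F).

Fixpoint chain (n : nat) (v : V) : V :=
  if n is m.+1 then A (chain m v) - th m *: chain m v else v.

Fact chain_linear n : linear (chain n).
Proof.
elim: n => [|n IHn] c v w //=; rewrite IHn linearP scalerDr opprD addrACA.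
by rewrite scalerBr !scalerA mulrC.
Qed.
HB.instance Definition _ n := GRing.isLinear.Build F V V _ (chain n) (@chain_linear n).

Lemma chain_eigen n a v :
  A v = a *: v -> chain n v = \prod_(i < n) (a - th i) *: v.
Proof.
move=> Av; elim: n => [|n IHn]; first by rewrite big_ord0 scale1r.
by rewrite /= big_ord_recr /= IHn linearZ /= Av; coords; ring.
Qed.

Lemma chainC m n v : chain m (chain n v) = chain n (chain m v).
Proof.
suff AC k w : chain k (A w) = A (chain k w).
  by elim: n => [|n IHn] //=; rewrite linearB linearZ /= AC IHn.
by elim: k => [|k IHk] //=; rewrite IHk [RHS]linearB /= [A (_ *: _)]linearZ.
Qed.

Variables (d : nat) (W : 'I_d.+1 -> {vspace V}).
Hypothesis A_W : forall i v, v \in W i -> A v = th i *: v.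
Hypothesis W_full : (\sum_i W i = fullv)%VS.

Lemma chain_last v : chain d.+1 v = 0.
Proof.
have: v \in fullv by exact: memvf.
rewrite -W_full => /memv_sumP[w Ww ->]; rewrite linear_sum big1 // => i _.
apply: etrans (chain_eigen _ (A_W (Ww i isT))) _.
by rewrite (bigD1 i) //= subrr mul0r scale0r.
Qed.

Variables (B : 'End(V)) (phi : nat -> F) (u : V).
Hypothesis irr : forall U : {vspace V},
    (A @: U <= U)%VS -> (B @: U <= U)%VS -> U = 0%VS \/ U = fullv.
Hypothesis u_neq0 : u != 0.
Hypothesis W_last : W ord_max != 0%VS.
Hypothesis th_inj : forall i, (i < d)%N -> th i != th d.
Hypothesis Bu : B u = th 0 *: u.
Hypothesis B_chain : forall n,
  B (chain n.+1 u) = th n.+1 *: chain n.+1 u + phi n.+1 *: chain n u.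

(* Otherwise the polynomial \prod_(i < d) (X - th i) would annihilate A on the
   cyclic space spanned by the chain, which is V by irreducibility. *)
Lemma chain_neq0 : chain d u != 0.
Proof.
apply/eqP => ud0; pose S := (\sum_(i < d.+1) <[chain i u]>)%VS.
have sub_S i : (i <= d.+1)%N -> chain i u \in S.
  rewrite leq_eqVlt => /orP[/eqP->|id]; first by rewrite chain_last mem0v.
  by apply: (@memv_sum_sup _ _ _ _ _ (Ordinal id)) => //; exact: memv_line.
have inv (f : 'End(V)) :
    (forall i, (i <= d)%N -> f (chain i u) \in S) -> (f @: S <= S)%VS.
  move=> fS; rewrite limg_sum; apply/subv_sumP => i _; rewrite limg_line.
  by rewrite -memvE fS // -ltnS.
have [S0|Sf] : S = 0%VS \/ S = fullv.
  apply: irr; apply: inv => i id.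
    rewrite -[A _](subrK (th i *: chain i u)) rpredD ?rpredZ ?sub_S ?leqW //.
    exact: (sub_S i.+1).
  case: i id => [_|i id]; first by rewrite Bu rpredZ // (sub_S 0%N).
  by rewrite B_chain rpredD // rpredZ // sub_S // ltnW // ltnW.
  by have := sub_S 0%N isT; rewrite S0 memv0 (negPf u_neq0).
pose z := vpick (W ord_max).
have: z \in S by rewrite Sf memvf.
case/memv_sumP => w Ww zE.
have: chain d z = 0.
  rewrite zE linear_sum big1 // => i _; have /vlineP[k ->] := Ww i isT.
  by rewrite linearZ /= chainC ud0 linear0 scaler0.
rewrite (chain_eigen _ (A_W (memv_pick _))) => /eqP.
rewrite scaler_eq0 vpick0 (negPf W_last) orbF => /eqP/eqP/prodf_eq0[i _].
by rewrite subr_eq0 eq_sym (negPf (th_inj (ltn_ord i))).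
Qed.

Lemma phi_last : phi d.+1 = 0.
Proof.
have /esym/eqP := B_chain d; rewrite chain_last scaler0 linear0 add0r scaler_eq0.
by rewrite (negPf chain_neq0) orbF => /eqP.
Qed.

End Chain.

(** * The eigenvalues [c] and [c'] *)

Section CasimirValue.
Variables (F : fieldType) (V : vectType F) (q xi : F) (d : nat).
Variables (A As x01 x23 : 'End(V)) (W : 'I_d.+1 -> {vspace V}).
Variables (th : nat -> F) (u : V) (c : F).
Hypotheses (q0 : q != 0) (q_nroot : forall n, (0 < n)%N -> q ^+ n != 1).
Hypothesis irr : forall U : {vspace V},
    (A @: U <= U)%VS -> (As @: U <= U)%VS -> U = 0%VS \/ U = fullv.
Hypothesis A_W : forall i v, v \in W i -> A v = th i *: v.
Hypothesis W_full : (\sum_i W i = fullv)%VS.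
Hypothesis W_last : W ord_max != 0%VS.
Hypothesis thS : forall i, th i.+1 = q ^+ 2 * th i.
Hypothesis th0E : th 0 = q ^- d.
Hypothesis w01 : forall v, x01 (A v) = q ^- 2 *: A (x01 v) + (1 - q ^- 2) *: v.
Hypothesis comm_AsA :
  forall v, As (A v) = A (As v) + ((q - q^-1) * xi) *: (x01 v - x23 v).
Hypothesis casimir_c :
  forall v, A (As v) + (q * xi) *: x01 v + (q^-1 * xi) *: x23 v = c *: v.
Hypothesis u_neq0 : u != 0.
Hypothesis As_u : As u = th 0 *: u.
Hypothesis x01_u : x01 u = (th 0)^-1 *: u.

Let thE n : th n = q ^+ (2 * n) * th 0.
Proof.
elim: n => [|n IHn]; first by rewrite muln0 mul1r.
by rewrite thS IHn mulrA -exprD mulnS.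
Qed.

Let th_neq0 n : th n != 0.
Proof. by rewrite thE th0E mulf_neq0 ?invr_eq0 ?expf_neq0. Qed.

Let u_ n := chain A th n u.

Let A_u n : A (u_ n) = u_ n.+1 + th n *: u_ n.
Proof. by rewrite /u_ /= subrK. Qed.

Let x01_u_ n : x01 (u_ n) = (th n)^-1 *: u_ n.
Proof.
elim: n => [|n IHn]; first exact: x01_u.
rewrite /u_ /= linearB linearZ /= w01 -/(u_ n) IHn thS.
by coords; field; rewrite q0 th_neq0.
Qed.

(** [casimir_c] expresses [x23] through the other maps, so that [As] can be followed along the chain
    from the actions of [A] and [x01] alone. *)
Let x23_elim v :
  As (A v) =
  q ^+ 2 *: A (As v) + ((q ^+ 3 - q^-1) * xi) *: x01 v - ((q ^+ 2 - 1) * c) *: v.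
Proof.
by rewrite comm_AsA -[(_ * c) *: v]scalerA -casimir_c; coords; field.
Qed.

(** [phi] solves the recurrence [phi_rec], whose homogeneous solutions are the multiples of [th n];
    [K] is the multiple that makes [phi 0] vanish. *)
Let K := - (c + q ^- 2 * th 0 ^+ 2 - q * xi / th 0) / th 0.
Let phi n := c + q ^- 2 * th n ^+ 2 - q * xi / th n + K * th n.

Let phi0 : phi 0 = 0.
Proof. by rewrite /phi /K; field; rewrite q0 th_neq0. Qed.

Let phi_rec n : phi n.+1 =
  q ^+ 2 * phi n + (q ^+ 2 - 1) * (th n ^+ 2 + (q + q^-1) * xi / th n - c).
Proof. by rewrite /phi thS; field; rewrite q0 th_neq0. Qed.

(** In the inductive step the [u_ n] terms cancel because [th n.+1 = q ^+ 2 * th n], and [phi_rec]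
    supplies the coefficient of [u_ n.+1]. In the base case [phi 0 = 0] stands for the absent
    predecessor of [u_ 0]. *)
Let As_u_ n :
  As (u_ n.+1) = th n.+1 *: u_ n.+1 + phi n.+1 *: u_ n.
Proof.
have As_uS m : As (u_ m.+1) = As (A (u_ m)) - th m *: As (u_ m).
  by rewrite -linearZ -linearB.
elim: n => [|n IHn]; rewrite As_uS x23_elim x01_u_ phi_rec.
  have -> : As (u_ 0) = th 0 *: u_ 0 by exact: As_u.
  rewrite linearZ /= (A_u 0) phi0 thS.
  by coords; field; rewrite q0 th_neq0.
rewrite IHn [A (_ + _)]linearD !linearZ /= !A_u (thS n.+1) [th n.+1]thS.
by coords; field; rewrite q0 th_neq0.
Qed.

(** With [t = q ^+ d.+1] one has [th 0 = q / t] and [th d.+1 = q * t], so [phi d.+1 = 0] becomes [(t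
    ^+ 2 - 1) * (1 + xi * (t + t^-1) - c) = 0]. *)
Lemma casimir_value : c = 1 + xi * (q ^+ d.+1 + q ^- d.+1).
Proof.
have th_inj i : (i < d)%N -> th i != th d.
  move=> id; have -> : th d = q ^+ (2 * (d - i)) * th i.
    by rewrite [LHS]thE [th i]thE mulrA -exprD -mulnDr subnK // ltnW.
  have qn : q ^+ (2 * (d - i)) != 1 by rewrite q_nroot // muln_gt0 subn_gt0.
  by rewrite -subr_eq0 -{1}[th i]mul1r -mulrBl mulf_neq0 // subr_eq0 eq_sym.
have := phi_last A_W W_full irr u_neq0 W_last th_inj As_u As_u_.
rewrite /phi /K thE th0E; have -> : (2 * d.+1 = d.+1 + d.+1)%N by rewrite mul2n addnn.
have -> : q ^- d = q / q ^+ d.+1.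
  by rewrite exprS invfM mulrA divff // mul1r.
rewrite exprD; set t := q ^+ d.+1 => H.
have t0 : t != 0 by rewrite expf_neq0.
have t2 : t ^+ 2 != 1 by rewrite -exprM q_nroot.
have {}H : (t ^+ 2 - 1) * (1 + xi * (t + t^-1) - c) = 0.
  by rewrite -[RHS]H; field; rewrite q0 t0.
move/eqP: H; rewrite mulf_eq0 subr_eq0 (negPf t2) /= subr_eq0 => /eqP<-.
by [].
Qed.

(** At [u] both relations involve only [A u], [x23 u] and [u], with [A u] and [x23 u] in the same
    proportion; subtracting [q / (th 0 * xi)] times the first eliminates both and gives [c'] in
    terms of [c]. *)
Lemma casimir'_value c' : xi != 0 ->
    (forall v, x23 (x01 v) + (q * xi^-1) *: A v + (q^-1 * xi^-1) *: As v = c' *: v) ->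
  xi ^+ 2 * c' = xi * (q ^+ d.+1 + q ^- d.+1) + xi ^+ 2.
Proof.
move=> xi0 /(_ u); have := casimir_c u; rewrite x01_u As_u [A _]linearZ [x23 (_ *: _)]linearZ /=.
set a := A u; set y := x23 u => E E'.
have t0 : q ^+ d.+1 != 0 by rewrite expf_neq0.
have th0t : th 0 = q / q ^+ d.+1 by rewrite th0E exprS invfM mulrA divff // mul1r.
have: (c' - (xi^-1 * (q ^+ d.+1 + q ^- d.+1) + 1)) *: u = 0.
  have {}E : (q / (th 0 * xi)) *: (th 0 *: a + (q * xi) *: ((th 0)^-1 *: u) +
     (q^-1 * xi) *: y) = (q / (th 0 * xi)) *: (c *: u) by rewrite E.
  have -> : (c' - (xi^-1 * (q ^+ d.+1 + q ^- d.+1) + 1)) *: u =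
    c' *: u - (q / (th 0 * xi)) *: (c *: u) +
    (q ^+ 2 / th 0 ^+ 2 - th 0 / (q * xi)) *: u.
    rewrite casimir_value th0t; coords; field.
    by rewrite ?q0 ?xi0 ?t0.
  rewrite -E -E'; coords; field.
  by rewrite ?q0 ?xi0 ?th_neq0.
move/eqP; rewrite scaler_eq0 (negPf u_neq0) orbF subr_eq0 => /eqP->.
by field; rewrite ?xi0 ?t0 ?q0.
Qed.

End CasimirValue.

(** * Coefficients of formal power series *)

Section PowerSeries.
Variable F : fieldType.
Implicit Types f g : fps F.

Lemma fps_coefM f g n : (f * g) n = \sum_(i < n.+1) f i * g (n - i)%N.
Proof. by []. Qed.

Lemma fps_coefXM f n : (fps_of_poly 'X * f) n = pred_term f n.
Proof.
rewrite fps_coefM; case: n => [|n]; first by rewrite big_ord1 /= coefX mul0r.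
rewrite 2!big_ord_recl /= !coefX mul0r mul1r subSS subn0 add0r big1 ?addr0 // => i _.
by rewrite coefX mul0r.
Qed.

Lemma fps_coefCM f (a : F) n : (fps_of_poly a%:P * f) n = a * f n.
Proof.
rewrite fps_coefM big_ord_recl /= coefC /= subn0 big1 ?addr0 // => i _.
by rewrite coefC mul0r.
Qed.

Lemma fps_of_polyM : {morph @fps_of_poly F : p p' / p * p'}.
Proof. by move=> p p'; apply: fpsP => n; rewrite fps_coefM /= coefM. Qed.

Lemma fps_pred (s : nat -> F) : Fps (pred_term s) = fps_of_poly 'X * Fps s.
Proof. by apply: fpsP => n; rewrite fps_coefXM. Qed.

Lemma fps_coef_linear f (a : F) n :
  (f * fps_of_poly (1 - a *: 'X)) n = f n - a * pred_term f n.
Proof.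
have -> : f * fps_of_poly (1 - a *: 'X) =
    f - fps_of_poly 'X * (f * fps_of_poly a%:P).
  rewrite mulrCA -fps_of_polyM -{2}[f]mulr1 -mulrBr; congr (_ * _).
  apply: fpsP => k; rewrite -[RHS]/((1 : {poly F})`_k - ('X * a%:P)`_k).
  by rewrite -coefB mulrC mul_polyC.
rewrite -[LHS]/(f n - (fps_of_poly 'X * (f * fps_of_poly a%:P)) n) fps_coefXM.
by case: n => [|n]; rewrite /pred_term ?mulr0 // mulrC fps_coefCM.
Qed.

End PowerSeries.

(** * The alternating elements acting on the module *)

Section Recursion.
Variables (F : fieldType) (V : vectType F) (U : algType F) (W0 W1 : U).
Variables (rho : U -> 'End(V)) (rho_module : module_structure rho).
Variables (q xi c c' : F) (x01 x12 x23 x30 : 'End(V)) (r : nat -> F).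
Hypotheses (q0 : q != 0) (q_nroot : forall n, (0 < n)%N -> q ^+ n != 1).
Hypotheses (xi0 : xi != 0) (x12_neq0 : x12 != 0).
Hypotheses (rho_W0 : rho W0 = x12) (rho_W1 : rho W1 = x30) (r0 : r 0 = 1).
Hypothesis w12 : forall v, x12 (x23 v) = q ^- 2 *: x23 (x12 v) + (1 - q ^- 2) *: v.
Hypothesis w23 : forall v, x23 (x30 v) = q ^- 2 *: x30 (x23 v) + (1 - q ^- 2) *: v.
Hypothesis comm_x30_x12 : forall v,
  x30 (x12 v) = x12 (x30 v) + ((q - q^-1) * xi) *: (x01 v - x23 v).
Hypothesis casimir_c :
  forall v, x12 (x30 v) + (q * xi) *: x01 v + (q^-1 * xi) *: x23 v = c *: v.
Hypothesis casimir_c' : forall v,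
  x23 (x01 v) + (q * xi^-1) *: x12 v + (q^-1 * xi^-1) *: x30 v = c' *: v.

Local Notation b := (q ^+ 2).
Hypothesis rho_Wneg : forall n,
  rho (Wneg b W0 W1 n) = r n *: x12 - (q * xi * pred_term r n) *: \1%VF.

HB.instance Definition _ :=
  GRing.isLinear.Build F U 'End(V) _ rho (module_linear rho_module).

Let rhoM x y v : rho (x * y) v = rho x (rho y v).
Proof. by rewrite (module_mul rho_module) comp_lfunE. Qed.

Let rhoD x y v : rho (x + y) v = rho x v + rho y v.
Proof. by rewrite linearD add_lfunE. Qed.

Let rhoZ a x v : rho (a *: x) v = a *: rho x v.
Proof. by rewrite linearZ scale_lfunE. Qed.

Let rhoB x y v : rho (x - y) v = rho x v - rho y v.
Proof. by rewrite linearB add_lfunE opp_lfunE. Qed.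

Let rho_sum (m n : nat) (f : nat -> U) v :
  rho (\sum_(m <= k < n) f k) v = \sum_(m <= k < n) rho (f k) v.
Proof. by rewrite linear_sum sum_lfunE. Qed.

(** With [R(t)] the series of [r], these are the coefficients of [R(t/b)], [(t/b) R(t/b)] and
    [R(t/b) R(t)]. *)
Let rb k := b ^- k * r k.
Let rb' k := b ^- k * pred_term r k.
Let C : nat -> F := Fps rb * Fps r.

Let rb'E : Fps rb' = fps_of_poly 'X * (fps_of_poly (b^-1)%:P * Fps rb).
Proof.
apply: fpsP => -[|k]; rewrite fps_coefXM; first by rewrite /= /rb' /= mulr0.
by rewrite [RHS]/pred_term fps_coefCM /rb' /rb /= exprS invfM mulrA.
Qed.

Let pC := pred_term C.
Let ppC := pred_term pC.

Let convE (f g : nat -> F) n : \sum_(0 <= k < n.+1) f k * g (n - k)%N = (Fps f * Fps g) n.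
Proof. by rewrite big_mkord. Qed.

Let conv_rr n : \sum_(0 <= k < n.+1) rb k * r (n - k)%N = C n.
Proof. exact: convE. Qed.

Let conv_rp n : \sum_(0 <= k < n.+1) rb k * pred_term r (n - k) = pC n.
Proof. by rewrite convE fps_pred mulrCA fps_coefXM. Qed.

Let pred_termZ (a : F) f n : pred_term (fun k => a * f k) n = a * pred_term f n.
Proof. by case: n => [|n] //=; rewrite mulr0. Qed.

Let conv_pr n : \sum_(0 <= k < n.+1) rb' k * r (n - k)%N = b^-1 * pC n.
Proof.
rewrite convE rb'E -!mulrA fps_coefXM -pred_termZ.
by case: n => [|n]; rewrite /pred_term // fps_coefCM.
Qed.

Let conv_pp n : \sum_(0 <= k < n.+1) rb' k * pred_term r (n - k) = b^-1 * ppC n.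
Proof.
rewrite convE rb'E fps_pred -!mulrA fps_coefXM -pred_termZ.
by case: n => [|n]; rewrite /pred_term // fps_coefCM mulrCA fps_coefXM.
Qed.

Let conv_vec (f g f' g' : nat -> F) n (v1 v2 v3 v4 : V) :
  \sum_(0 <= k < n.+1) (f k *: (g (n - k)%N *: v1 - g' (n - k)%N *: v2)
     - f' k *: (g (n - k)%N *: v3 - g' (n - k)%N *: v4)) =
  (\sum_(0 <= k < n.+1) f k * g (n - k)%N) *: v1
  - (\sum_(0 <= k < n.+1) f k * g' (n - k)%N) *: v2
  - (\sum_(0 <= k < n.+1) f' k * g (n - k)%N) *: v3
  + (\sum_(0 <= k < n.+1) f' k * g' (n - k)%N) *: v4.
Proof.
rewrite !scaler_suml -!sumrN -!big_split /=; apply: eq_bigr => k _.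
by coords; ring.
Qed.

(** The expected actions, written without [rho] so that they are available at an index that the
    induction has not yet reached. *)
Let G n v := r n *: v - (q * xi * pred_term r n) *: x23 v.
Let Gt n v := r n *: v - (q * xi * pred_term r n) *: x01 v.

(** [b ^+ n.+1 = -1] would make [q] a root of unity. *)
Let b_neq0 n : 1 + b ^- n.+1 != 0.
Proof.
have bn0 : b ^+ n.+1 != 0 by rewrite !expf_neq0.
have : (b ^+ n.+1) ^+ 2 != 1 by rewrite -!exprM q_nroot // !muln_gt0.
rewrite -subr_eq0 -[X in _ - X](expr1n _ 2) subr_sqr mulf_eq0 negb_or => /andP[_].
apply: contraNneq => E; rewrite -[b ^+ _ + _]mulr1 -(mulfV bn0) mulrCA mulrDl.
by rewrite divff // mul1r E mulr0.
Qed.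

Let b1_neq0 : b - 1 != 0.
Proof. by rewrite subr_eq0 q_nroot. Qed.

(* The coefficient of t^n in R(t/b) R(t) (1 - c t + xi^2 c' t^2 - xi^2 t^3). *)
Definition recursion_defect n :=
  C n - c * pC n + xi ^+ 2 * c' * ppC n - xi ^+ 2 * pred_term ppC n.

(** The recursion gives the expected action of the next [Gelt] up to a scalar [e] proportional to
    the defect. This propagates as [e *: x12] to the action of the next [Wneg], which is prescribed
    by [rho_Wneg], so [e = 0]: the coefficient identity and the expected actions come out
    together. *)
Lemma recursion_step m :
    (forall k v, (k <= m)%N ->
       [/\ rho (Gelt b W0 W1 k) v = G k v, rho (Gtelt b W0 W1 k) v = Gt k v &
           rho (Wpos b W0 W1 k) v = r k *: x30 v - (q * xi * pred_term r k) *: v]) ->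
  recursion_defect m.+1 = 0 /\
  (forall v,
       [/\ rho (Gelt b W0 W1 m.+1) v = G m.+1 v, rho (Gtelt b W0 W1 m.+1) v = Gt m.+1 v &
           rho (Wpos b W0 W1 m.+1) v = r m.+1 *: x30 v - (q * xi * r m) *: v]).
Proof.
move=> IH; set n := m.+1; have prn : pred_term r n = r m by [].
have sumW v : rho (\sum_(0 <= k < n) b ^- k *: (Wneg b W0 W1 k * Wpos b W0 W1 (n - k).-1)) v
   = C m *: x12 (x30 v) - (q * xi * pC m) *: x12 v - (q^-1 * xi * pC m) *: x30 v
     + (xi ^+ 2 * ppC m) *: v.
  rewrite rho_sum.
  transitivity (\sum_(0 <= k < m.+1) (rb k *: (r (m - k)%N *: x12 (x30 v)
         - (pred_term r (m - k)) *: ((q * xi) *: x12 v))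
     - rb' k *: (r (m - k)%N *: ((q * xi) *: x30 v) -
                 pred_term r (m - k) *: ((q * xi) ^+ 2 *: v)))).
    apply: eq_big_nat => k /=; rewrite ltnS => km.
    rewrite rhoZ rhoM rho_Wneg /n subSn //=.
    have [_ _ ->] := IH (m - k)%N v (leq_subr _ _).
    rewrite !(add_lfunE, opp_lfunE, scale_lfunE, id_lfunE) /rb /rb'.
    by coords; ring.
  rewrite conv_vec conv_rr conv_rp conv_pr conv_pp.
  by coords; field; rewrite ?q0.
have sumG v : rho (\sum_(1 <= k < n) b ^- k *: (Gelt b W0 W1 k * Gtelt b W0 W1 (n - k))) v
  = C n *: v - (q * xi * C m) *: x01 v - (q^-1 * xi * C m) *: x23 v
    + (xi ^+ 2 * pC m) *: x23 (x01 v) - Gt n v - b ^- n *: G n v.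
  (* The sum is completed by the terms [k = 0] and [k = n], in which [Gt n] and [G n] replace the
     actions of [Gtelt] and [Gelt] at [n], still unknown here. *)
  have full : \sum_(0 <= k < n.+1) b ^- k *: G k (Gt (n - k) v) =
      C n *: v - (q * xi * C m) *: x01 v - (q^-1 * xi * C m) *: x23 v
      + (xi ^+ 2 * pC m) *: x23 (x01 v).
    transitivity (\sum_(0 <= k < n.+1) (rb k *: (r (n - k)%N *: v
         - (pred_term r (n - k)) *: ((q * xi) *: x01 v))
     - rb' k *: (r (n - k)%N *: ((q * xi) *: x23 v) -
                 pred_term r (n - k) *: ((q * xi) ^+ 2 *: x23 (x01 v))))).
      apply: eq_big_nat => k _; rewrite /G /Gt /rb /rb' linearB !linearZ /=.
      by coords; ring.
    rewrite conv_vec conv_rr conv_rp conv_pr conv_pp.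
    by coords; field; rewrite ?q0.
  have split (h : nat -> V) : \sum_(0 <= k < m.+2) h k =
      h 0 + \sum_(0 <= k < m) h k.+1 + h m.+1.
    by rewrite big_nat_recl // big_nat_recr //= addrA.
  rewrite -full split -/n subn0 subnn.
  have -> : G 0 (Gt n v) = Gt n v by rewrite /G r0 /= mulr0 scale0r subr0 scale1r.
  have -> : Gt 0 v = v by rewrite /Gt r0 /= mulr0 scale0r subr0 scale1r.
  rewrite expr0 invr1 scale1r [RHS]addrAC addrK [Gt n v + _]addrC addrK.
  rewrite rho_sum big_add1 /=; apply: eq_big_nat => k /= km.
  rewrite rhoZ rhoM.
  have [_ -> _] := IH (n - k.+1)%N v (leq_subr _ _).
  by have [-> _ _] := IH k.+1 (Gt (n - k.+1) v) km.
have commW v : rho (comm (Wpos b W0 W1 m) W0) v =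
    (r m * (q - q^-1) * xi) *: (x01 v - x23 v).
  rewrite /comm rhoB !rhoM rho_W0.
  have [_ _ ->] := IH m (x12 v) (leqnn _); have [_ _ ->] := IH m v (leqnn _).
  rewrite linearB !linearZ /= comm_x30_x12.
  by coords; field.
pose e := recursion_defect n / (1 + b ^- n).
(* Before division by [1 + b ^- n], the commutator term turns the boundary term [Gt n v] into
   [G n v], so the boundary terms add up to [(1 + b ^- n) *: G n v]; by the two Casimir relations
   the rest is minus the defect times [v]. *)
have GE v : rho (Gelt b W0 W1 n) v = G n v - e *: v.
  have x12x30 : x12 (x30 v) = c *: v - (q * xi) *: x01 v - (q^-1 * xi) *: x23 v.
    by rewrite -casimir_c; coords; ring.
  have x23x01 : x23 (x01 v) = c' *: v - (q / xi) *: x12 v - (q^-1 / xi) *: x30 v.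
    by rewrite -casimir_c'; coords; ring.
  rewrite GeltS rhoD !rhoZ rhoB sumW sumG commW x12x30 x23x01.
  rewrite -/n /G /Gt /e prn.
  have -> : recursion_defect n =
    C n - c * C m + xi ^+ 2 * c' * pC m - xi ^+ 2 * ppC m by [].
  have := b_neq0 m; rewrite -/n; set B := b ^- n => B1.
  by coords; field; rewrite q0 xi0 B1 b1_neq0.
have GtE v : rho (Gtelt b W0 W1 n) v = Gt n v - e *: v.
  rewrite GteltS -/n rhoD rhoZ GE.
  have -> : rho (comm W0 (Wpos b W0 W1 m)) v = - rho (comm (Wpos b W0 W1 m) W0) v.
    by rewrite !rhoB opprB.
  rewrite commW /G /Gt prn.
  by coords; field; rewrite q0 b1_neq0.
have WnegE v : rho (Wneg b W0 W1 n) v = r n *: x12 v - (q * xi * r m) *: v - e *: x12 v.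
  rewrite WnegS -/n rhoZ /qcomm rhoB rhoZ !rhoM rho_W0 !GE /G prn.
  rewrite !linearB !linearZ /= w12.
  by coords; field; rewrite q0 b1_neq0.
have e0 : e = 0.
  apply/eqP; apply: contraNT x12_neq0 => e_neq0; apply/eqP/lfunP => v.
  rewrite zero_lfunE; apply/eqP; move: (WnegE v).
  rewrite rho_Wneg !(add_lfunE, opp_lfunE, scale_lfunE, id_lfunE) /=.
  move=> /eqP; rewrite -subr_eq0 opprB addrC subrK scaler_eq0 (negPf e_neq0).
  by [].
split=> [|v].
  move/eqP: e0; rewrite mulf_eq0 invr_eq0 (negPf (b_neq0 m)) orbF.
  by move/eqP.
rewrite GE GtE e0 scale0r !subr0; split=> //.
rewrite WposS -/n rhoZ /qcomm rhoB rhoZ !rhoM rho_W1 !GE e0 !scale0r !subr0.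
rewrite /G prn linearB !linearZ /= w23.
by coords; field; rewrite q0 b1_neq0.
Qed.

Lemma recursion_defect0 n : recursion_defect n.+1 = 0.
Proof.
suff IH k : forall j v, (j <= k)%N ->
       [/\ rho (Gelt b W0 W1 j) v = G j v, rho (Gtelt b W0 W1 j) v = Gt j v &
           rho (Wpos b W0 W1 j) v = r j *: x30 v - (q * xi * pred_term r j) *: v].
  by have [] := recursion_step (IH n).
elim: k => [|k IHk] j v.
  rewrite leqn0 => /eqP->; have [_ -> -> ->] := alt0 b W0 W1.
  rewrite /G /Gt (module_one rho_module) rho_W1 id_lfunE r0 /= mulr0 !scale0r !subr0.
  by rewrite !scale1r.
rewrite leq_eqVlt => /orP[/eqP->|]; last exact: IHk.
by have [_ /(_ v)] := recursion_step IHk.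
Qed.

End Recursion.

(** With [s = q ^+ d.+1], the values of [c] and [c'] factor the cubic as
    [(1 - t)(1 - xi s t)(1 - xi t / s)]; replacing [t] by [q t] gives the stated denominator and
    turns [R(t/b) R(t)] into [R(t/q) R(q t)]. *)
Lemma series_of_recursion (F : fieldType) (q xi c c' : F) (d : nat) (r : nat -> F) :
    q != 0 -> xi != 0 -> r 0 = 1 ->
    c = 1 + xi * (q ^+ d.+1 + q ^- d.+1) ->
    xi ^+ 2 * c' = xi * (q ^+ d.+1 + q ^- d.+1) + xi ^+ 2 ->
    (forall n, recursion_defect q xi c c' r n.+1 = 0) ->
  fps_subst (Fps r) q * fps_subst (Fps r) q^-1 =
  (fps_of_poly ((1 - q *: 'X) *
                (1 - (q ^+ (d + 2) * xi) *: 'X) *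
                (1 - (q ^- d * xi) *: 'X)))^-1.
Proof.
move=> q0 xi0 r0 cE c'E defect0.
pose C : fps F := Fps (fun k => (q ^+ 2) ^- k * r k) * Fps r.
set Y := _ * _.
have YE n : Y n = q ^+ n * C n.
  rewrite /Y mulrC !fps_coefM mulr_sumr; apply: eq_bigr => i _ /=.
  have -> : q ^+ n = q ^+ i * q ^+ (n - i) by rewrite -exprD subnKC // -ltnS.
  rewrite exprVn exprAC expr2 invfM.
  by field; rewrite expf_neq0.
have C0 : C 0 = 1 by rewrite /C fps_coefM big_ord1 /= r0 expr0 invr1 !mulr1.
apply/esym/mulr1_eq; rewrite mulrC !fps_of_polyM !mulrA.
have qd : q ^+ (d + 2) = q * q ^+ d.+1 by rewrite addn2 exprS.
have qVd : q ^- d = q / q ^+ d.+1 by rewrite exprS invfM mulrA divff // mul1r.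
have t0 : q ^+ d.+1 != 0 by rewrite expf_neq0.
apply: fpsP => n; rewrite !fps_coef_linear qd qVd.
case: n => [|n].
  rewrite /pred_term !mulr0 !subr0 YE C0 mulr1 expr0.
  by rewrite [RHS]/= coef1.
have := defect0 n; rewrite /recursion_defect c'E cE -/C.
move: qd qVd {cE c'E} t0; set s := q ^+ d.+1 => _ _ s0 dn.
rewrite (_ : (1 : fps F) n.+1 = q ^+ n.+1 * 0); last first.
  by rewrite mulr0 -[LHS]/((1 : {poly F})`_n.+1) coef1.
rewrite -[X in _ = _ * X]dn.
by case: n dn => [|[|n]] _; do 3! rewrite /pred_term ?fps_coef_linear; rewrite !YE ?exprS;
  field.
Qed.

(** * From a tridiagonal system to its eigenspaces and operators *)

Section TridiagonalSystem.
Variables (F : fieldType) (V : vectType F) (d : nat).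

(** Diagonalizability makes the [W i] span, as each nonzero eigenspace is one of them; then [E i],
    known on every [W j], has image [W i]. *)
Lemma idempotents_decomposition (A B : 'End(V)) (E : 'I_d.+1 -> 'End(V)) :
    lfun_diagonalizable A -> standard_idempotents A B E ->
  (\sum_i limg (E i) = fullv)%VS /\ tridiagonal_on B (fun i => limg (E i)).
Proof.
move=> [s s_full] [W [[W_inj W_eig] trid] idem].
have W_full : (\sum_i W i = fullv)%VS.
  apply/eqP; rewrite eqEsubv subvf -s_full /=.
  elim: s {s_full} => [|a s IHs]; first by rewrite big_nil sub0v.
  rewrite big_cons subv_add IHs andbT.
  have [->|a_eig] := eqVneq (passmx.leigenspace A a) 0%VS; first exact: sub0v.
  have [i <-] : exists i, W i = passmx.leigenspace A a by apply/W_eig; exists a.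
  exact: (sumv_sup i).
have EW i : limg (E i) = W i.
  apply/eqP; rewrite eqEsubv; apply/andP; split; apply/subvP => v.
    case/memv_imgP => w _ ->; have: w \in (\sum_i W i)%VS by rewrite W_full memvf.
    case/memv_sumP => ws Ww ->; rewrite linear_sum; apply: rpred_sum => j _.
    by rewrite /= (idem _ _ _ (Ww j isT)); case: eqP => [->|_]; rewrite ?Ww ?mem0v.
  move=> Wv; have <- : E i v = v by rewrite (idem i i v Wv) eqxx.
  by rewrite memv_img ?memvf.
split; first by apply: etrans W_full; apply: eq_bigr => i _; exact: EW.
by move=> i; rewrite EW; under eq_bigr do rewrite EW; exact: trid.
Qed.

Lemma tridiagonal_rev (B : 'End(V)) (W : 'I_d.+1 -> {vspace V}) :
  tridiagonal_on B W -> tridiagonal_on B (fun i => W (rev_ord i)).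
Proof.
move=> trid i; apply: subv_trans (trid _) _; rewrite (reindex_inj rev_ord_inj) /=.
apply/subv_sumP => j /andP[ji ij]; apply: (sumv_sup j) => //.
by move: (ltn_ord i) (ltn_ord j) ji ij; lia.
Qed.

Lemma sumv_rev (W : 'I_d.+1 -> {vspace V}) :
  (\sum_i W (rev_ord i) = \sum_i W i)%VS.
Proof. by rewrite [RHS](reindex_inj rev_ord_inj). Qed.

Lemma sumv_rev_le (W : 'I_d.+1 -> {vspace V}) (i : 'I_d.+1) :
  (\sum_(j : 'I_d.+1 | (j <= i)%N) W (rev_ord j) =
   \sum_(j : 'I_d.+1 | (d - i <= j)%N) W j)%VS.
Proof.
rewrite [RHS](reindex_inj rev_ord_inj); apply: eq_bigl => j /=.
by move: (ltn_ord i) (ltn_ord j); lia.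
Qed.

Lemma sumv_rev_ge (W : 'I_d.+1 -> {vspace V}) (i : 'I_d.+1) :
  (\sum_(j : 'I_d.+1 | (i <= j)%N) W (rev_ord j) =
   \sum_(j : 'I_d.+1 | (j <= d - i)%N) W j)%VS.
Proof.
rewrite [RHS](reindex_inj rev_ord_inj); apply: eq_bigl => j /=.
by move: (ltn_ord i) (ltn_ord j); lia.
Qed.

Lemma eigenvalue_sequenceP (A : 'End(V)) (E : 'I_d.+1 -> 'End(V)) theta i v :
  eigenvalue_sequence A E theta -> (v \in limg (E i)) = (A v == theta i *: v).
Proof.
move=> /(_ i)[_ ->]; rewrite memv_ker.
by rewrite !(add_lfunE, opp_lfunE, scale_lfunE, id_lfunE) subr_eq0.
Qed.

End TridiagonalSystem.

Theorem theorem10p14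
  (F : fieldType) (q : F)
  (q_neq0 : q != 0) (q_not_root : forall n : nat, (0 < n)%N -> q ^+ n != 1)
  (V : vectType F) (d : nat) (d_ge1 : (1 <= d)%N)
  (A As : 'End(V)) (E Es : 'I_d.+1 -> 'End(V))
  (Phi_TD : TD_system A E As Es)
  (dim_E : forall i, \dim (limg (E i)) = 1%N)
  (dim_Es : forall i, \dim (limg (Es i)) = 1%N)
  (eig_A : eigenvalue_sequence A E (fun i => q ^ (2 * i%:Z - d%:Z)))
  (eig_As : eigenvalue_sequence As Es (fun i => q ^ (d%:Z - 2 * i%:Z)))
  (rho : Uqplus (q ^+ 2) -> 'End(V)) (rho_module : module_structure rho)
  (rho_W0 : rho (uqW0 (q ^+ 2)) = A) (rho_W1 : rho (uqW1 (q ^+ 2)) = As)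
  (x01 x12 x23 x30 : 'End(V))
  (x12_def : x12 = A) (x30_def : x30 = As)
  (x01_def : forall i : 'I_d.+1,
     acts_as_on x01 (q ^ (d%:Z - 2 * i%:Z))
       ((\sum_(j : 'I_d.+1 | (d - i <= j)%N) limg (Es j)) :&:
        (\sum_(j : 'I_d.+1 | (i <= j)%N) limg (E j)))%VS)
  (x23_def : forall i : 'I_d.+1,
     acts_as_on x23 (q ^ (2 * i%:Z - d%:Z))
       ((\sum_(j : 'I_d.+1 | (j <= i)%N) limg (Es j)) :&:
        (\sum_(j : 'I_d.+1 | (j <= d - i)%N) limg (E j)))%VS)
  (xi : F) (xi_neq0 : xi != 0)
  (xi_def1 : xi *: (x01 - x23) = (q - q^-1)^-1 *: lfun_comm x30 x12)
  (xi_def2 : xi^-1 *: (x12 - x30) = (q - q^-1)^-1 *: lfun_comm x01 x23)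
  (r : nat -> F) (r0 : r 0%N = 1)
  (r_def : forall n : nat,
     rho (Wneg (q ^+ 2) (uqW0 (q ^+ 2)) (uqW1 (q ^+ 2)) n) =
     r n *: x12 - (q * xi * pred_term r n) *: \1%VF) :
  let R : fps F := Fps r in
  fps_subst R q * fps_subst R q^-1 =
  (fps_of_poly ((1 - q *: 'X) *
                (1 - (q ^+ (d + 2) * xi) *: 'X) *
                (1 - (q ^- d * xi) *: 'X)))^-1.
Proof.
move=> R; case: Phi_TD => [[_ diagA diagAs _ _ irr] idemE idemEs].
have [E_full As_trid] := idempotents_decomposition diagA idemE.
have [Es_full A_trid] := idempotents_decomposition diagAs idemEs.
have eigA i v := eigenvalue_sequenceP i v eig_A.
have eigAs i v := eigenvalue_sequenceP i v eig_As.
have limE0 i : limg (E i) != 0%VS by rewrite -dimv_eq0 dim_E.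
have limEs0 i : limg (Es i) != 0%VS by rewrite -dimv_eq0 dim_Es.
pose th n : F := q ^ (2 * n%:Z - d%:Z).
have q2 : q ^+ 2 != 0 by rewrite expf_neq0.
have thS n : th n.+1 = q ^+ 2 * th n.
  rewrite /th (_ : 2 * n.+1%:Z - d%:Z = 2 + (2 * n%:Z - d%:Z)); last by lia.
  by rewrite expfzDr.
have th_neq0 n : th n != 0 by rewrite expfz_neq0.
have th0E : th 0 = q ^- d by rewrite /th mulr0 sub0r exprnN.
have thV n : (th n)^-1 = q ^ (d%:Z - 2 * n%:Z) by rewrite /th invr_expz opprB.
(* The dual eigenvalue sequence, which is also [th] read backwards. *)
pose th' n : F := (th n)^-1.
have th'S n : th' n.+1 = q ^- 2 * th' n by rewrite /th' thS invfM.
have th'_neq0 n : th' n != 0 by rewrite invr_eq0.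
have th_rev (i : 'I_d.+1) : th (rev_ord i) = th' i.
  by rewrite /th' thV /th /=; congr (_ ^ _); move: (ltn_ord i); lia.
have th'_rev (i : 'I_d.+1) : th' (rev_ord i) = th i by rewrite -th_rev rev_ordK.
have A_E (i : 'I_d.+1) v : v \in limg (E i) -> A v = th i *: v.
  by rewrite eigA => /eqP.
have As_Es (i : 'I_d.+1) v : v \in limg (Es i) -> As v = th' i *: v.
  by rewrite eigAs /th' thV => /eqP.
(* Reversing the dual eigenspaces gives both maps the eigenvalue sequence [th], as [split_weyl]
   requires. *)
have weyl01 v : x01 (A v) = q ^- 2 *: A (x01 v) + (1 - q ^- 2) *: v /\
                As (x01 v) = q ^- 2 *: x01 (As v) + (1 - q ^- 2) *: v.
  apply: (@split_weyl _ _ d A As (fun i => limg (E i)) (fun i => limg (Es (rev_ord i))) th)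
    => //.
  - by move=> i w /As_Es; rewrite th'_rev.
  - exact: (tridiagonal_rev A_trid).
  - move=> i w; rewrite /split_space (sumv_rev_le (fun i => limg (Es i))) thV.
    exact: x01_def.
(* Here the eigenspaces of [A] are reversed instead; the common sequence is [th'], of ratio
   [q ^- 2]. *)
have weyl23 v : x23 (A v) = (q ^- 2)^-1 *: A (x23 v) + (1 - (q ^- 2)^-1) *: v /\
                As (x23 v) = (q ^- 2)^-1 *: x23 (As v) + (1 - (q ^- 2)^-1) *: v.
  apply: (@split_weyl _ _ d A As (fun i => limg (E (rev_ord i))) (fun i => limg (Es i)) th')
    => //.
  - by move=> i w /A_E; rewrite th_rev.
  - exact: (tridiagonal_rev As_trid).
  - by rewrite (sumv_rev (fun i => limg (E i))).
  - by rewrite invr_eq0.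
  - move=> i w; rewrite /split_space (sumv_rev_ge (fun i => limg (E i))) /th' invrK.
    exact: x23_def.
have w01 v := proj1 (weyl01 v).
have w30 v := proj2 (weyl01 v).
have w12 v : A (x23 v) = q ^- 2 *: x23 (A v) + (1 - q ^- 2) *: v.
  by rewrite (proj1 (weyl23 v)); coords; field; rewrite q_neq0 oner_neq0.
have w23 v : x23 (As v) = q ^- 2 *: As (x23 v) + (1 - q ^- 2) *: v.
  by rewrite (proj2 (weyl23 v)); coords; field; rewrite q_neq0 oner_neq0.
have qV : q - q^-1 != 0.
  have := q_not_root 2 isT; apply: contraNneq => /eqP; rewrite subr_eq0 => /eqP qq.
  by rewrite expr2 {2}qq divff.
have comm_AsA v : As (A v) = A (As v) + ((q - q^-1) * xi) *: (x01 v - x23 v).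
  have /(congr1 (fun f : 'End(V) => (q - q^-1) *: f v)) := xi_def1.
  rewrite /lfun_comm x12_def x30_def.
  rewrite !(add_lfunE, opp_lfunE, scale_lfunE, comp_lfunE) !scalerA divff // scale1r.
  by move=> ->; rewrite addrC subrK.
pose u := vpick (limg (Es ord_max)).
have u_neq0 : u != 0 by rewrite vpick0.
have u_Es : u \in limg (Es ord_max) by exact: memv_pick.
have Es_line : limg (Es ord_max) = <[u]>%VS.
  apply/esym/eqP; rewrite eqEdim -memvE u_Es dim_Es dim_vline u_neq0.
  by [].
have As_u : As u = th 0 *: u.
  by rewrite (As_Es _ _ u_Es) -(th'_rev ord0); congr (th' _ *: u); rewrite /= subn1.
have x01_u : x01 u = (th 0)^-1 *: u.
  rewrite thV; apply: (x01_def ord0); rewrite memv_cap; apply/andP; split.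
    by apply: memv_sum_sup u_Es; rewrite /= leq_subr.
  by have : u \in (\sum_i limg (E i))%VS by rewrite E_full memvf.
have scalar (Z : 'End(V)) : (forall v, Z (A v) = A (Z v)) ->
    (forall v, Z (As v) = As (Z v)) -> exists c, forall v, Z v = c *: v.
  (* [Z] commutes with [As], so it preserves the line spanned by [u], which makes [u] an eigenvector
     of [Z]. *)
  move=> ZA ZAs; have: Z u \in limg (Es ord_max).
    by rewrite eigAs -ZAs (As_Es _ _ u_Es) /th' thV linearZ.
  rewrite Es_line => /vlineP[c Zu]; exists c.
  exact: schur irr ZA ZAs u_neq0 Zu.
have [c casimir_c] := scalar _ (casimirA q_neq0 w01 w12 comm_AsA)
  (casimirAs q_neq0 w30 w23 comm_AsA).
have [c' casimir_c'] := scalar _ (casimir'A q_neq0 xi_neq0 w01 w12 comm_AsA)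
  (casimir'As q_neq0 xi_neq0 w30 w23 comm_AsA).
have {}casimir_c v : A (As v) + (q * xi) *: x01 v + (q^-1 * xi) *: x23 v = c *: v.
  by rewrite -casimir_c casimirE.
have {}casimir_c' v :
    x23 (x01 v) + (q * xi^-1) *: A v + (q^-1 * xi^-1) *: As v = c' *: v.
  by rewrite -casimir_c' casimir'E.
have cE : c = 1 + xi * (q ^+ d.+1 + q ^- d.+1).
  exact: (casimir_value q_neq0 q_not_root irr A_E E_full (limE0 ord_max) thS th0E w01
    comm_AsA casimir_c u_neq0 As_u x01_u).
have c'E : xi ^+ 2 * c' = xi * (q ^+ d.+1 + q ^- d.+1) + xi ^+ 2.
  exact: (casimir'_value q_neq0 q_not_root irr A_E E_full (limE0 ord_max) thS th0E w01
    comm_AsA casimir_c u_neq0 As_u x01_u xi_neq0 casimir_c').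
apply: (series_of_recursion q_neq0 xi_neq0 r0 cE c'E).
apply: (recursion_defect0 rho_module q_neq0 q_not_root xi_neq0 _ rho_W0 rho_W1 r0 w12 w23
  comm_AsA casimir_c casimir_c' _) => [|n]; last by rewrite r_def x12_def.
(* [A] is nonzero because its eigenvalue on [limg (E ord_max)] is an integer power of [q]. *)
apply: contraNneq u_neq0 => A0.
have := A_E ord_max _ (memv_pick (limg (E ord_max))); rewrite A0 zero_lfunE => /esym/eqP.
by rewrite scaler_eq0 (negPf (th_neq0 _)) vpick0 (negPf (limE0 _)).
Qed.
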